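(* For fixed integers $1\le l<m$, $$f(n-m,n-l,n)\sim\frac{(2n)^{m-l}}{(m-l)!}\qquad\text{as } n\to\infty.$$
   Context: $a_n\sim b_n$ means $a_n/b_n\to 1$ as $n\to\infty$. $G_{n,k}$ is the set of $k$-dimensional linear subspaces of $\mathbb{R}^n$ with its normalized rotation-invariant probability measure (the image of normalized Haar measure on the orthogonal group $O(n)$ under $g\mapsto g(\mathrm{span}(e_1,\dots,e_k))$, where $e_1,\dots,e_n$ is the standard basis). For integers $0\le j<k<n$, $f(j,k,n)$ denotes the expected number of $j$-dimensional faces of the polytope $X\cap[-1,1]^n$, where $X$ is random in $G_{n,k}$ according to this measure. *)

(* Defs.v *)
From HB Require Import structures.
From mathcomp Require Import all_boot all_order all_algebra.
From mathcomp Require Import all_classical all_reals all_analysis.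

Set Implicit Arguments.
Unset Strict Implicit.
Unset Printing Implicit Defensive.

Import Order.TTheory GRing.Theory Num.Theory.
Import numFieldNormedType.Exports.

Local Open Scope classical_set_scope.
Local Open Scope ring_scope.

(* 'M[R]_n with the Borel sigma-algebra of its usual topology. *)
Notation borel_mx R n := (g_sigma_algebraType (@open 'M[R]_n)).

Definition orthogonal_mx (R : realType) (n : nat) : set 'M[R]_n :=
  [set g | g^T *m g = 1%:M].

(* Normalized Haar measure on O(n), seen as a Borel probability measure on
   'M[R]_n carried by the closed subset O(n). As O(n) is compact, there is
   exactly one such measure; it is also right invariant. *)
Definition is_haar_On (R : realType) (n : nat)
    (mu : probability (borel_mx R n) R) : Prop :=
  mu (@orthogonal_mx R n) = 1%E /\
  forall (h : 'M[R]_n) (B : set (borel_mx R n)),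
    orthogonal_mx h -> measurable B ->
    mu [set g : 'M[R]_n | B (h *m g)] = mu B.

Definition std_span (R : realType) (n k : nat) : {vspace 'cV[R]_n} :=
  <<[seq (delta_mx i 0%R : 'cV[R]_n) | i : 'I_n <- enum 'I_n & (i < k)%N]>>%VS.

(* The image g(span(e_1, ..., e_k)); for Haar-distributed g this is a uniform
   random point of the Grassmannian G_{n,k}. *)
Definition rand_subspace (R : realType) (n k : nat) (g : 'M[R]_n) :
    {vspace 'cV[R]_n} :=
  (linfun (mulmx g) @: std_span R n k)%VS.

Definition cube (R : realType) (n : nat) : set 'cV[R]_n :=
  [set x | forall i, -1 <= x i 0 <= 1].

Definition dotcv (R : realType) (n : nat) (c x : 'cV[R]_n) : R :=
  \sum_i c i 0 * x i 0.

(* F is cut out of P by a valid linear inequality c.x <= d; both the empty set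
   and P itself are faces. *)
Definition is_face (R : realType) (n : nat) (P F : set 'cV[R]_n) : Prop :=
  exists (c : 'cV[R]_n) (d : R),
    (forall x, P x -> dotcv c x <= d) /\
    F = P `&` [set x | dotcv c x = d].

(* The affine hull of S is x0 + V with dim V = j; in particular S is nonempty. *)
Definition has_aff_dim (R : realType) (n : nat) (S : set 'cV[R]_n) (j : nat) :
    Prop :=
  exists (x0 : 'cV[R]_n) (V : {vspace 'cV[R]_n}),
    [/\ S x0, \dim V = j, forall x, S x -> x - x0 \in V &
        forall W : {vspace 'cV[R]_n},
          (forall x, S x -> x - x0 \in W) -> (V <= W)%VS].

Definition faces (R : realType) (n j : nat) (P : set 'cV[R]_n) :
    set (set 'cV[R]_n) :=
  [set F | is_face P F /\ has_aff_dim F j].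

(* The expected number f(j, k, n), where mu is the Haar measure of O(n). *)
Definition expected_faces (R : realType) (j k n : nat)
    (mu : probability (borel_mx R n) R) : \bar R :=
  (\int[mu]_g
     counting (faces j ([set` rand_subspace k (g : 'M[R]_n)] `&` @cube R n)))%E.

Definition asymp_equiv (R : realType) (a : nat -> \bar R) (b : nat -> R) :
    Prop :=
  (a n * ((b n)^-1)%:E)%E @[n --> \oo] --> 1%E.

(* Main.v *)
Require Import Defs.
From HB Require Import structures.
From mathcomp Require Import all_boot all_order all_algebra.
From mathcomp Require Import finmap.
From mathcomp Require Import all_classical all_reals all_analysis.
From mathcomp Require Import measurable_realfun.
From mathcomp Require Import ring lra zify.
Import Order.TTheory GRing.Theory Num.Theory.
Import numFieldNormedType.Exports.
Local Open Scope classical_set_scope.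
Local Open Scope ring_scope.

(** Put [d = m - l]. The cube has [N = 2 ^ d * 'C(n, d)] faces of codimension
    [d], and [N] is equivalent to [(2 n) ^ d / d!]. It is therefore enough to
    show that the number of faces of dimension [n - m] of the section by a
    subspace [X] of codimension [l] is never more than [N], and that it equals
    [N] with probability tending to [1].

    The upper bound is deterministic ([faces_sub_sections]): a face of
    codimension [d] in the section is cut out by [d] of the facet equations
    [x i = 1] and [x i = -1], with independent equations on [X], so that it is
    the trace of a cube face of codimension [d].

    Equality holds as soon as [X] crosses every cube face of codimension [d]
    transversally in its relative interior ([counting_faces_eq]). The
    orthogonal complement of [X] is spanned by the last [l] columns of the
    orthogonal matrix [g]. If the entries of these columns are small enough, in
    terms of [d] and [l] only, the projection onto [X] is so close to the
    identity on any [d] coordinates that they can be prescribed at will by a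
    vector of [X] whose other coordinates stay inside the cube
    ([meets_all_faces_flat]).

    That these entries are small follows from invariance alone. Replacing two
    coordinates [u] and [v] by their normalised sum and difference relates the
    fourth moments of two entries of a column to the mean of [u ^ 2 v ^ 2], and
    as columns are unit vectors the fourth moments of the [n] entries of a
    column add up to at most [3 / n] ([sum_entry_moment4]). By Markov's
    inequality all entries of the last [l] columns are small with probability
    [1 - O(1 / n)] ([flat_event_likely]), and the expected number of faces lies
    between [N (1 - O(1 / n))] and [N]. *)

Set Implicit Arguments.
Unset Strict Implicit.
Unset Printing Implicit Defensive.

(** * Coordinate sections of a subspace *)

Section CoordinateSections.
Variables (R : realType) (n : nat).
Implicit Types (X U : {vspace 'cV[R]_n}) (D : {set 'I_n}) (x v : 'cV[R]_n).

Definition coord_ker (i : 'I_n) : {vspace 'cV[R]_n} :=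
  lker (linfun (row i : 'cV[R]_n -> 'rV[R]_1)).

Lemma memv_coord_ker i v : (v \in coord_ker i) = (v i 0 == 0).
Proof.
rewrite memv_ker lfunE /=; apply/eqP/eqP => [/rowP/(_ 0)|v0]; first by rewrite !mxE.
by apply/rowP => a; rewrite !mxE (ord1 a).
Qed.

Lemma dim_coord_ker U i :
  (\dim (U :&: coord_ker i) + ~~ (U <= coord_ker i)%VS)%N = \dim U.
Proof.
have [sUi|nUi] := boolP (U <= coord_ker i)%VS.
  by rewrite (capv_idPl sUi) addn0.
rewrite -(limg_ker_dim (linfun (row i : 'cV[R]_n -> 'rV[R]_1)) U) -/(coord_ker i).
congr (_ + _)%N; apply/eqP; rewrite eqn_leq lt0n dimv_eq0 -lkerE nUi.
by rewrite (leq_trans (dimvS (subvf _))) // dimvf /= /dim /= muln1.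
Qed.

Definition coord_section X D : {vspace 'cV[R]_n} :=
  (X :&: \bigcap_(i in D) coord_ker i)%VS.

Lemma coord_sectionP X D v :
  reflect (v \in X /\ forall i, i \in D -> v i 0 = 0) (v \in coord_section X D).
Proof.
rewrite memv_cap; apply: (iffP andP) => -[vX vD]; split=> //.
  move=> i iD; apply/eqP; rewrite -memv_coord_ker memvE.
  by apply: (subv_trans vD); apply: bigcapv_inf (subvv _).
by rewrite memvE; apply/subv_bigcapP => i iD; rewrite -memvE memv_coord_ker vD.
Qed.

Lemma coord_sectionU1 X D i :
  coord_section X (i |: D) = (coord_section X D :&: coord_ker i)%VS.
Proof.
apply/vspaceP => v; rewrite memv_cap memv_coord_ker.
apply/coord_sectionP/andP => [[vX vD]|[/coord_sectionP[vX vD] /eqP vi]].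
  split; last by rewrite vD // setU11.
  by apply/coord_sectionP; split=> // k kD; rewrite vD // inE kD orbT.
by split=> // k /setU1P[->|/vD].
Qed.


(** Adding the coordinates of [D0] one at a time, each new one either holds on
    the current section already or cuts its dimension by exactly one; keeping
    only the latter leaves as many coordinates as the dimension drops. *)
Lemma coord_section_basis X D0 : exists D : {set 'I_n},
  [/\ D \subset D0, coord_section X D = coord_section X D0 &
      (#|D| + \dim (coord_section X D))%N = \dim X].
Proof.
have [k] := ubnP #|D0|; elim: k D0 => // k IHk D0.
have [->|[i iD0]] := set_0Vmem D0 => [_|].
  exists finset.set0; split; rewrite ?sub0set // cards0 add0n; congr (\dim _).
  by apply/vspaceP => v; apply/coord_sectionP/idP => [[]//|vX]; split=> // i; rewrite inE.
rewrite (cardsD1 i) iD0 ltnS => /IHk [D [sD eqL dimL]].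
have iD : i \notin D by apply/negP => /(fintype.subsetP sD); rewrite setD11.
have dimLi := dim_coord_ker (coord_section X D) i.
have eqLi : coord_section X D0 = (coord_section X D :&: coord_ker i)%VS.
  by rewrite eqL -coord_sectionU1 finset.setD1K.
have [sLi|nsLi] := boolP (coord_section X D <= coord_ker i)%VS.
  exists D; split=> //; last by rewrite eqLi; apply/esym/capv_idPl.
  by rewrite (fintype.subset_trans sD) // subD1set.
rewrite nsLi in dimLi; exists (i |: D); split.
- by rewrite finset.subUset finset.sub1set iD0 (fintype.subset_trans sD) // subD1set.
- by rewrite coord_sectionU1 eqLi.
- by rewrite coord_sectionU1 cardsU1 iD -dimL -dimLi /=; ring.
Qed.

(** The witnesses say that no coordinate of [D] vanishes on the section cut out
    by the others, so the basis selected by [coord_section_basis] must be all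
    of [D]. *)
Lemma dim_coord_section X D :
  (forall i, i \in D -> exists v, [/\ v \in X, v i 0 != 0 &
     forall k, k \in D -> k != i -> v k 0 = 0]) ->
  (#|D| + \dim (coord_section X D))%N = \dim X.
Proof.
move=> indep; have [D' [sD' eqL dimL]] := coord_section_basis X D.
suff -> : D = D' by [].
apply/eqP; rewrite finset.eqEsubset sD' andbT; apply/fintype.subsetP => i iD.
apply/negPn/negP => iD'; have [v [vX vi vD]] := indep i iD.
have : v \in coord_section X D'.
  apply/coord_sectionP; split=> // k kD'; apply: vD; first exact: (fintype.subsetP sD').
  by apply: contraNneq iD' => <-.
by rewrite eqL => /coord_sectionP[_ /(_ i iD)] /eqP; rewrite (negPf vi).
Qed.
End CoordinateSections.

(** * Faces of a central section of the cube *)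

Section CubeSections.
Variables (R : realType) (n : nat) (X : {vspace 'cV[R]_n}).
Implicit Types (x y v : 'cV[R]_n) (D E : {set 'I_n}).

Local Notation P := ([set` X] `&` @cube R n).

Lemma cubeP x : cube x <-> forall i, `|x i 0| <= 1.
Proof. by split=> xc i; move: (xc i); rewrite ler_norml. Qed.

Lemma dotcvD (c x y : 'cV[R]_n) : dotcv c (x + y) = dotcv c x + dotcv c y.
Proof. by rewrite /dotcv -big_split; apply: eq_bigr => i _; rewrite mxE mulrDr. Qed.

Lemma dotcvZ (c x : 'cV[R]_n) a : dotcv c (a *: x) = a * dotcv c x.
Proof.
by rewrite /dotcv big_distrr; apply: eq_bigr => i _; rewrite mxE /=; ring.
Qed.

Definition tight x : {set 'I_n} := [set i | `|x i 0| == 1].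

(** A direction that vanishes on the tight coordinates can be followed a little
    way, both forwards and backwards, without leaving the cube. *)
Lemma cube_perturb y v :
  cube y -> (forall i, i \in tight y -> v i 0 = 0) ->
  exists e : R, [/\ 0 < e, cube (y + e *: v) & cube (y - e *: v)].
Proof.
move=> /cubeP yc vy.
have near_e : \forall e \near (0 : R)^'+, forall i,
    e * `|v i 0| <= 1 - `|y i 0|.
  apply: filter_forall => i; have [iy|niy] := boolP (i \in tight y).
    by apply: nearW => e; rewrite vy // normr0 mulr0 subr_ge0.
  have y1 : `|y i 0| < 1 by rewrite lt_neqAle yc andbT; rewrite inE in niy.
  have v1 : 0 < `|v i 0| + 1 by rewrite ltr_wpDl.
  near=> e.
  apply: (@le_trans _ _ (e * (`|v i 0| + 1))).
    by rewrite ler_wpM2l // lerDl.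
  rewrite -ler_pdivlMr //; near: e; apply: nbhs_right_le.
  by rewrite divr_gt0 // subr_gt0.
(* One step size serves all coordinates, as there are finitely many. *)
have [e [e0 ve]] : exists e : R, 0 < e /\ forall i, e * `|v i 0| <= 1 - `|y i 0|.
  near (0 : R)^'+ => e; exists e; split; first by [].
  by near: e; exact: near_e.
exists e; split=> //; apply/cubeP => i; have := ve i.
  rewrite !mxE lerBrDl => /(le_trans _); apply.
  by rewrite (le_trans (ler_normD _ _)) // normrM (gtr0_norm e0).
rewrite !mxE lerBrDl => /(le_trans _); apply.
by rewrite (le_trans (ler_normB _ _)) // normrM (gtr0_norm e0).
Unshelve. all: by end_near. Qed.

(** A point of [F] with the fewest tight coordinates does the job of a relative
    interior point: if some [x] in [F] differed from it at one of its tight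
    coordinates, their midpoint would have strictly fewer. *)
Lemma relint_point F y0 : is_face P F -> F y0 ->
  exists2 y, F y & forall x i, F x -> i \in tight y -> x i 0 = y i 0.
Proof.
move=> [c [a [valid FE]]] Fy0.
have exk : exists k, `[< exists y, F y /\ #|tight y| = k >].
  by exists #|tight y0|; apply/asboolP; exists y0.
case: (ex_minnP exk) => k /asboolP[y [Fy cardy]] ymin; exists y => // x i Fx iy.
apply/eqP/negPn/negP => xyi.
pose z := 2^-1 *: x + 2^-1 *: y.
have zE k' : z k' 0 = 2^-1 * (x k' 0 + y k' 0) by rewrite !mxE mulrDr.
move: (Fx) (Fy); rewrite FE => -[[xX xc] /= cx] [[yX yc] /= cy].
have Fz : F z.
  rewrite FE; split; last by rewrite /= dotcvD !dotcvZ cx cy; lra.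
  split; first by rewrite /= rpredD // rpredZ.
  by move=> k'; rewrite zE; have := xc k'; have := yc k'; lra.
have szy : tight z \subset tight y :\ i.
  have half k' : k' \in tight z -> x k' 0 = y k' 0 /\ `|y k' 0| = 1.
    rewrite inE zE; have := xc k'; have := yc k' => /andP[y1 y2] /andP[x1 x2].
    rewrite eqr_norml => /andP[/orP[] /eqP e _].
      have -> : y k' 0 = 1 by lra.
      by split; [lra|rewrite normr1].
    have -> : y k' 0 = -1 by lra.
    by split; [lra|rewrite normrN normr1].
  apply/fintype.subsetP => k' /half[xyk' yk']; rewrite !inE yk' eqxx andbT.
  by apply: contraNneq xyi => <-; rewrite xyk'.
have := ymin #|tight z|; rewrite -cardy leqNgt => /(_ _)/negP; apply.
  by apply/asboolP; exists z.
by rewrite (leq_ltn_trans (subset_leq_card szy)) // [ltnRHS](cardsD1 i) iy.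
Qed.

Definition sgnv E (i : 'I_n) : R := if i \in E then 1 else -1.

Lemma normr_sgnv E i : `|sgnv E i| = 1.
Proof. by rewrite /sgnv; case: ifP; rewrite ?normrN normr1. Qed.

(** A face of the cube is encoded by the set [p.1] of coordinates that it fixes
    and the subset [p.2] of those fixed at [1], the others being fixed at
    [-1]. *)
Definition cube_face_section (p : {set 'I_n} * {set 'I_n}) : set 'cV[R]_n :=
  P `&` [set x | forall i, i \in p.1 -> x i 0 = sgnv p.2 i].

Definition signed_sets (d : nat) : {set {set 'I_n} * {set 'I_n}} :=
  [set p : {set 'I_n} * {set 'I_n} | (#|p.1| == d) && (p.2 \subset p.1)]%SET.

Lemma card_signed_sets (d : nat) : #|signed_sets d| = (2 ^ d * 'C(n, d))%N.
Proof.
rewrite -[n in 'C(n, d)]card_ord -card_draws mulnC -sum_nat_const.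
rewrite -sum1_card (eq_bigl (fun p : {set 'I_n} * {set 'I_n} =>
   (p.1 \in [set D : {set 'I_n} | #|D| == d]%SET) && (p.2 \in powerset p.1))); last first.
  by move=> p; rewrite !inE.
rewrite -(pair_big_dep
  (fun D : {set 'I_n} => D \in [set D : {set 'I_n} | #|D| == d]%SET)
  (fun D E => E \in powerset D) (fun _ _ => 1%N)) /=.
apply: eq_bigr => D; rewrite inE => /eqP <-.
by rewrite -card_powerset sum1_card.
Qed.

(** The upper bound on the number of faces, valid for every subspace, however
    degenerate. A supporting functional of [F] vanishes on the directions of
    [X] that keep the tight coordinates of a relative interior point [y], so
    these are the directions of the affine hull of [F], and [F] is recovered
    from the tight coordinates. As the dimension of [F] is [j], already [d] of
    these coordinates suffice. *)
Lemma faces_sub_sections d j : \dim X = (d + j)%N ->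
  faces j P `<=` cube_face_section @` [set` signed_sets d].
Proof.
move=> dimX F [faceF [x0 [V [Fx0 dimV FV minV]]]].
have [y Fy ytight] := relint_point faceF Fx0.
case: faceF => c [a [valid FE]].
move: (Fy); rewrite FE => -[[yX yc] /= cy].
pose L := coord_section X (tight y).
have LP v : v \in L -> dotcv c v = 0 /\ v \in V.
  move=> /coord_sectionP[vX vy].
  have [e [e0 c1 c2]] := cube_perturb yc vy.
  have P1 : P (y + e *: v) by split=> //; rewrite /= rpredD // rpredZ.
  have P2 : P (y - e *: v) by split=> //; rewrite /= rpredB // rpredZ.
  have cv : dotcv c v = 0.
    have := valid _ P1; have := valid _ P2.
    rewrite -scaleNr !dotcvD !dotcvZ cy => h1 h2.
    have h : e * dotcv c v = 0 by lra.
    by move/eqP: h; rewrite mulf_eq0 gt_eqF //= => /eqP.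
  split=> //; have Fyv : F (y + e *: v).
    by rewrite FE; split; rewrite //= dotcvD dotcvZ cv mulr0 addr0.
  have : e *: v \in V.
    have -> : e *: v = (y + e *: v - x0) - (y - x0).
      by rewrite opprB addrA subrK addrAC subrr add0r.
    by rewrite rpredB // FV.
  by rewrite rpredZeq gt_eqF.
have VL : (V <= L)%VS.
  apply: minV => x Fx; apply/coord_sectionP.
  move: (Fx) (Fx0); rewrite {1 2}FE => -[[xX _] _] [[x0X _] _].
  split; first by rewrite rpredB.
  by move=> i iy; rewrite !mxE (ytight x) // (ytight x0) // subrr.
have dimL : \dim L = j.
  rewrite -dimV; apply/eqP; rewrite eqn_leq !dimvS //.
  by apply/subvP => v /LP[].
have [D [sD eqL]] := coord_section_basis X (tight y).
rewrite eqL -/L dimL dimX => /addIn cardD.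
exists (D, [set i in D | y i 0 == 1]%SET).
  by rewrite /= inE /= cardD eqxx; apply/fintype.subsetP => i; rewrite inE => /andP[].
have yD i : i \in D -> y i 0 = sgnv [set k in D | y k 0 == 1]%SET i.
  move=> iD; rewrite /sgnv inE iD /=; case: eqP => // y1.
  by have := fintype.subsetP sD i iD; rewrite inE eqr_norml (introF eqP y1) => /andP[/eqP].
apply/seteqP; split=> x.
  move=> [[xX xc] /= xD]; split=> //=.
  have : x - y \in L.
    rewrite /L -eqL; apply/coord_sectionP; split; first by rewrite rpredB.
    by move=> i iD; rewrite !mxE xD // yD // subrr.
  by move=> /LP[+ _]; rewrite -scaleN1r dotcvD dotcvZ cy; lra.
rewrite -FE => Fx; split; first by move: Fx; rewrite FE => -[].
by move=> i iD /=; rewrite (ytight x) // ?yD //; exact: (fintype.subsetP sD).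
Qed.

(** [X] crosses the relative interior of every face of codimension [d]. Allowing
    all [s] bounded by one, and not only sign vectors, also encodes that these
    crossings are transversal. *)
Definition meets_all_faces d := forall D (s : 'I_n -> R), #|D| = d ->
  (forall i, `|s i| <= 1) ->
  exists y, [/\ y \in X, forall i, i \in D -> y i 0 = s i &
                forall i, i \notin D -> `|y i 0| < 1].

Lemma is_face_section (p : {set 'I_n} * {set 'I_n}) :
  is_face P (cube_face_section p).
Proof.
case: p => D E.
(* The functional sums the signed coordinates in [D], each at most one, and
   [t] records the deficits. *)
exists (\col_i (if i \in D then sgnv E i else 0)), (#|D|%:R).
pose t x i := if i \in D then 1 - sgnv E i * x i 0 else 0 : R.
have dotE x : dotcv (\col_i (if i \in D then sgnv E i else 0)) x =
    #|D|%:R - \sum_i t x i.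
  rewrite -sum1_card natr_sum big_mkcond /= -sumrB; apply: eq_bigr => i _.
  by rewrite /t mxE; case: ifP => _; ring.
have t0 x i : cube x -> 0 <= t x i.
  rewrite /t /sgnv => /(_ i); case: ifP => // _.
  by case: ifP => _; lra.
split=> [x [_ xc]|].
  by rewrite dotE gerBl sumr_ge0 // => i _; exact: t0.
apply/seteqP; split=> x [[xX xc] /= h]; split=> //=.
  rewrite dotE big1 ?subr0 // => i _; rewrite /t; case: ifP => // iD.
  by rewrite h //= /sgnv; case: ifP => _; lra.
move=> i iD; have : \sum_i t x i == 0 by apply/eqP; move: h; rewrite dotE; lra.
rewrite psumr_eq0 => [/allP/(_ i)|k _]; last exact: t0.
rewrite mem_index_enum => /(_ isT) /eqP; rewrite /t iD /sgnv.
by case: ifP => _; lra.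
Qed.

(** Taking basis vectors for [s] in [meets_all_faces] shows that the coordinates
    of [D] are independent on [X], which gives the dimension of the section;
    [cube_perturb] at a point of the relative interior of the cube face shows
    that it is not smaller. *)
Lemma has_aff_dim_section d j (p : {set 'I_n} * {set 'I_n}) :
  \dim X = (d + j)%N -> meets_all_faces d -> #|p.1| = d ->
  has_aff_dim (cube_face_section p) j.
Proof.
case: p => D E /= dimX meet cardD.
have sgn1 i : `|sgnv E i| <= 1 by rewrite normr_sgnv.
have [y [yX yD y1]] := meet D (sgnv E) cardD sgn1.
have yc : cube y.
  apply/cubeP => i; have [iD|/y1/ltW//] := boolP (i \in D).
  by rewrite yD.
have dimL : (d + \dim (coord_section X D))%N = \dim X.
  rewrite -cardD; apply: dim_coord_section => i iD.
  have [|v [vX vD _]] := meet D (fun k => (k == i)%:R) cardD.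
    by move=> k; case: eqP; rewrite ?normr1 ?normr0.
  exists v; split=> // [|k kD ki]; first by rewrite vD // eqxx oner_eq0.
  by rewrite vD // (negPf ki).
exists y, (coord_section X D); split=> //.
- by apply: (@addnI d); rewrite dimL.
- move=> x [[xX _] /= xD]; apply/coord_sectionP; split; first by rewrite rpredB.
  by move=> i iD; rewrite !mxE xD // yD // subrr.
move=> W FW; apply/subvP => v /coord_sectionP[vX vD].
have [|e [e0 c1 _]] := @cube_perturb y v yc.
  move=> i; rewrite inE => yi; apply: vD; apply: contraLR yi => /y1.
  by move/lt_eqF => ->.
have : e *: v \in W.
  have -> : e *: v = y + e *: v - y by rewrite addrAC subrr add0r.
  apply: FW; split; first by split=> //; rewrite /= rpredD // rpredZ.
  by move=> i iD /=; rewrite !mxE vD // mulr0 addr0 yD.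
by rewrite rpredZeq gt_eqF.
Qed.

(** A point of [X] in the relative interior of a cube face reveals that face: its
    coordinates of absolute value one are the fixed ones, with their signs. *)
Lemma cube_face_section_inj d : meets_all_faces d ->
  {in signed_sets d &, injective cube_face_section}.
Proof.
move=> meet [D E] [D' E']; rewrite !inE /= => /andP[/eqP cD sE] /andP[/eqP cD' sE'].
move=> eqS; have [|y [yX yD y1]] := meet D (sgnv E) cD.
  by move=> i; rewrite normr_sgnv.
have [_ /= yD'] : cube_face_section (D', E') y.
  rewrite -eqS; split=> //; split=> //; apply/cubeP => i.
  have [iA|/y1/ltW//] := boolP (i \in D).
  by rewrite yD // normr_sgnv.
have eqD : D' = D.
  apply/eqP; rewrite eqEcard cD cD' leqnn andbT; apply/fintype.subsetP => i /yD' yi.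
  by apply: contraT => /y1; rewrite yi normr_sgnv ltxx.
congr (_, _) => //; apply/finset.setP => i; move: (yD i) (yD' i).
rewrite eqD; have [iD|niD] := boolP (i \in D).
  move=> /(_ isT) -> /(_ isT); rewrite /sgnv.
  by case: (i \in E); case: (i \in E') => //; lra.
rewrite (contraNF (fintype.subsetP sE i) niD) (contraNF (fintype.subsetP sE' i)) // eqD //.
Qed.

Lemma faces_eq_sections d j : \dim X = (d + j)%N -> meets_all_faces d ->
  faces j P = cube_face_section @` [set` signed_sets d].
Proof.
move=> dimX meet; apply/seteqP; split; first exact: faces_sub_sections.
move=> _ [p + <-]; rewrite /= inE => /andP[/eqP cardp _].
by split; [exact: is_face_section|exact: has_aff_dim_section meet cardp].
Qed.

Lemma sections_fset d : cube_face_section @` [set` signed_sets d] =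
  [set` [fset cube_face_section p | p in signed_sets d]%fset].
Proof.
apply/seteqP; split=> F /= => [[p pT <-]|/imfsetP[p pT ->]]; last by exists p.
by apply/imfsetP; exists p.
Qed.

Local Open Scope ereal_scope.

Lemma counting_faces_le d j : \dim X = (d + j)%N ->
  counting (faces j P) <= (2 ^ d * 'C(n, d))%:R%:E :> \bar R.
Proof.
move=> /faces_sub_sections sub.
rewrite sections_fset in sub.
have fin := sub_finite_set sub (finite_fset _).
rewrite /counting asboolT // lee_fin ler_nat -card_signed_sets cardE.
have : (fset_set (faces j P) `<=` [fset cube_face_section p | p in signed_sets d])%fset.
  by rewrite -[X in (_ `<=` X)%fset]set_fsetK -fset_set_sub.
by move/fsubset_leq_card/leq_trans; apply; apply: leq_trans (leq_imfset_card _ _ _) _.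
Qed.

Lemma counting_faces_eq d j : \dim X = (d + j)%N -> meets_all_faces d ->
  counting (faces j P) = (2 ^ d * 'C(n, d))%:R%:E :> \bar R.
Proof.
move=> dimX meet; rewrite (faces_eq_sections dimX meet).
rewrite sections_fset.
rewrite /counting asboolT // set_fsetK card_in_imfset /=.
  by rewrite -cardE card_signed_sets.
exact: cube_face_section_inj.
Qed.

End CubeSections.

(** * Spans of the first columns of an orthogonal matrix *)

Section RandomSubspace.
Variables (R : realType) (n : nat).
Implicit Types (g : 'M[R]_n) (k : nat).

Lemma std_spanE k :
  std_span R n k = coord_section fullv [set i : 'I_n | (k <= i)%N]%SET.
Proof.
apply/eqP; rewrite eqEsubv; apply/andP; split.
  apply/span_subvP => _ /mapP[i + ->]; rewrite mem_filter => /andP[ik _].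
  apply/coord_sectionP; split=> [|j]; first exact: memvf.
  rewrite inE => kj; rewrite mxE andbT; case: eqP => // ji.
  by move: ik; rewrite -ji ltnNge kj.
apply/subvP => v /coord_sectionP[_ vk].
rewrite (matrix_sum_delta v) memv_suml // => i _; rewrite big_ord1.
have [ik|ki] := ltnP i k; last by rewrite vk ?inE // scale0r mem0v.
by rewrite memvZ // memv_span //; apply: map_f; rewrite mem_filter ik mem_enum.
Qed.

Lemma card_ord_geq k : #|[set i : 'I_n | (k <= i)%N]%SET| = (n - k)%N.
Proof.
rewrite -sum1_card (eq_bigl (fun i : 'I_n => k <= i)%N) => [|i]; last by rewrite inE.
by rewrite -(big_geq_mkord _ _ predT (fun=> 1%N)) sum_nat_const_nat muln1.
Qed.

Lemma dim_std_span k : (k <= n)%N -> \dim (std_span R n k) = k.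
Proof.
move=> kn; apply: (@addnI (n - k)%N); rewrite subnK // -{1}card_ord_geq std_spanE.
rewrite dim_coord_section => [|i ik]; first by rewrite dimvf /dim /= muln1.
exists (delta_mx i 0); split; first exact: memvf.
  by rewrite mxE !eqxx oner_eq0.
by move=> j _ /negPf ji; rewrite mxE ji.
Qed.

Lemma dim_rand_subspace g k : orthogonal_mx g -> (k <= n)%N ->
  \dim (rand_subspace k g) = k.
Proof.
move=> og kn; rewrite -[RHS](dim_std_span kn); apply: limg_dim_eq.
apply/eqP; rewrite -subv0; apply/subvP => v; rewrite memv_cap memv_ker lfunE /=.
move=> /andP[_ /eqP gv]; rewrite memv0.
by rewrite -[v]mul1mx -og -mulmxA gv mulmx0.
Qed.

(** The index maximising [`|v i|] can be fed back into the contraction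
    hypothesis. *)
Lemma sup_contraction (v : 'I_n -> R) (b : R) :
  (forall B, (forall j, `|v j| <= B) -> forall i, `|v i| <= b + 4^-1 * B) ->
  forall i, `|v i| <= 4 / 3 * b.
Proof.
move=> contr i.
case: (@Order.TotalTheory.arg_maxP _ _ _ i xpredT (fun j => `|v j|) isT) => j _ vj.
have vle l : `|v l| <= `|v j| by exact: vj.
by have := contr _ vle j; have := vle i; lra.
Qed.

(** The [n - k] columns of [g] with index at least [k] are orthonormal and span
    the orthogonal complement of [X]; let [Q] be the projection onto it. Every
    [y = (1 - Q) z] lies in [X]. When these columns have small entries so
    does [Q], hence the block of [1 - Q] on [D] is a small perturbation of the
    identity in the sup norm, and some [z] supported on [D] has [y = s] there.
    This [z] is bounded by [4 / 3] and [y] by [1 / 3] outside of [D]. *)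
Lemma meets_all_faces_flat g k d (eps : R) : orthogonal_mx g ->
  (forall i a : 'I_n, (k <= a)%N -> g i a ^+ 2 <= eps) ->
  d%:R * ((n - k)%:R * eps) <= 4^-1 ->
  meets_all_faces (rand_subspace k g) d.
Proof.
move=> og flat small D s cardD s1.
have ogT : g *m g^T = 1%:M by apply: mulmx1C.
pose Q i j : R := \sum_(a < n | (k <= a)%N) g i a * g j a.
have QC i j : Q i j = Q j i by apply: eq_bigr => a _; rewrite mulrC.
have Qle i j : `|Q i j| <= (n - k)%:R * eps.
  rewrite (le_trans (ler_norm_sum _ _ _)) //.
  apply: (@le_trans _ _ (\sum_(a < n | (k <= a)%N) eps)).
    apply: ler_sum => a ka; have := flat i a ka; have := flat j a ka.
    rewrite ler_norml => h1 h2; apply/andP.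
    by split; nra.
  rewrite sumr_const mulr_natl; move: (card_ord_geq k).
  by rewrite cardsE => ->.
have Dsum (z : 'I_n -> R) B i : (forall j, `|z j| <= B) ->
    `|\sum_(j in D) Q i j * z j| <= 4^-1 * B.
  move=> zB; rewrite (le_trans (ler_norm_sum _ _ _)) //.
  apply: (@le_trans _ _ (\sum_(j in D) (n - k)%:R * eps * B)).
    by apply: ler_sum => j _; rewrite normrM ler_pM.
  rewrite sumr_const cardD -[leLHS]mulr_natl mulrA ler_wpM2r //.
  by apply: le_trans (zB i).
pose M := \matrix_(i, j) (if (i \in D) && (j \in D) then Q i j else 0).
have zM (z : 'rV[R]_n) i : (z *m M) 0 i =
    if i \in D then \sum_(j in D) Q i j * z 0 j else 0.
  rewrite mxE; case: ifP => iD; last first.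
    by rewrite big1 // => j _; rewrite mxE iD andbF mulr0.
  rewrite [RHS]big_mkcond; apply: eq_bigr => j _; rewrite mxE iD andbT.
  by case: ifP => _; rewrite ?mulr0 // QC mulrC.
have zMle (z : 'rV[R]_n) B i : (forall j, `|z 0 j| <= B) ->
    `|(z *m M) 0 i| <= 4^-1 * B.
  move=> zB; rewrite zM; case: ifP => _; first exact: Dsum.
  by rewrite normr0 mulr_ge0 // (le_trans _ (zB i)).
have unitA : (1%:M - M) \in unitmx.
  rewrite unitmxE unitfE; apply/det0P => -[z /eqP z0]; rewrite mulmxBr mulmx1.
  move=> /eqP; rewrite subr_eq0 => /eqP zE; apply: z0; apply/rowP => i.
  rewrite mxE; apply/eqP; rewrite -normr_le0.
  rewrite (le_trans (@sup_contraction (z 0) 0 _ i)) ?mulr0 //.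
  by move=> B zB l; rewrite add0r {1}zE zMle.
pose sr : 'rV[R]_n := \row_i (if i \in D then s i else 0).
(* On vectors supported on [D], as [z] turns out to be, [1 - M] agrees with
   [1 - Q] in the coordinates of [D]. *)
have [z zA] : exists z : 'rV[R]_n, z *m (1%:M - M) = sr.
  by exists (sr *m invmx (1%:M - M)); rewrite mulmxKV.
have zE i : z 0 i = sr 0 i + (z *m M) 0 i.
  by rewrite -zA mulmxBr mulmx1 [in RHS]mxE [(- (z *m M)) _ _]mxE subrK.
have z43 i : `|z 0 i| <= 4 / 3.
  rewrite (le_trans (@sup_contraction (z 0) 1 _ i)) ?mulr1 // => B zB l.
  rewrite zE (le_trans (ler_normD _ _)) // lerD ?zMle //.
  by rewrite mxE; case: ifP => _; rewrite ?s1 // normr0.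
pose w : 'cV[R]_n := \col_a (if (k <= a)%N then 0 else (g^T *m z^T) a 0).
exists (g *m w).
have yE i : (g *m w) i 0 = z 0 i - \sum_(j in D) Q i j * z 0 j.
  have -> : \sum_(j in D) Q i j * z 0 j = \sum_j Q i j * z 0 j.
    rewrite big_mkcond; apply: eq_bigr => j _; case: ifP => // jD.
    by rewrite zE zM mxE jD addr0 mulr0.
  have -> : z 0 i = (g *m (g^T *m z^T)) i 0 by rewrite mulmxA ogT mul1mx [RHS]mxE.
  rewrite [in RHS]mxE mxE (bigID (fun a : 'I_n => (k <= a)%N)) /= big1; last first.
    by move=> a ka; rewrite mxE ka mulr0.
  rewrite [in RHS](bigID (fun a : 'I_n => (k <= a)%N)) /=.
  rewrite add0r [X in X + _ - _](_ : _ = \sum_j Q i j * z 0 j).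
    rewrite addrAC subrr add0r; apply: eq_bigr => a /negPf ka.
    by rewrite mxE ka.
  under [RHS]eq_bigr do rewrite mulr_suml.
  rewrite exchange_big /=; apply: eq_bigr => a ka.
  rewrite mxE mulr_sumr; apply: eq_bigr => j _.
  by rewrite !mxE mulrA.
split.
- rewrite -(lfunE (mulmx g)) memv_img // std_spanE.
  apply/coord_sectionP; split; first exact: memvf.
  by move=> a; rewrite inE mxE => ->.
- move=> i iD; rewrite yE; have := zE i; rewrite zM mxE iD => ->.
  by rewrite addrK.
move=> i iD; rewrite yE.
have -> : z 0 i = 0 by rewrite zE zM mxE (negPf iD) addr0.
rewrite sub0r normrN (le_lt_trans (Dsum _ _ _ z43)) //; lra.
Qed.

End RandomSubspace.

(** * Borel measurability on square matrices *)

Section BorelMatrices.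
Variables (R : realType) (n : nat).
Local Notation T := (borel_mx R n).
Local Notation O := (@orthogonal_mx R n : set T).

Lemma open_measurable_mx (A : set 'M[R]_n) : open A -> measurable (A : set T).
Proof. by move=> oA; apply: sub_sigma_algebra. Qed.

Lemma measurable_entry (i a : 'I_n) : measurable_fun [set: T] (fun g : T => (g : 'M[R]_n) i a).
Proof.
apply: (measurability _ (RGenOpens.measurableE R)).
move=> _ [_ [c [b ->] <-]]; rewrite setTI; apply: open_measurable_mx.
by move/continuousP : (@coord_continuous R n n i a); apply; exact: interval_open.
Qed.

Lemma entry_mulmx_continuous (h : 'M[R]_n) (i j : 'I_n) :
  continuous (fun N : 'M[R]_n => (h *m N) i j).
Proof.
under eq_fun do rewrite mxE.
move=> M; apply: (@cvg_big _ _ _ _ _ _ _ _ _ _ _ (nbhs_filter M)) => [|k _].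
  exact: add_continuous.
by apply: cvgMr; exact: coord_continuous.
Qed.

Lemma mulmx_continuous (h : 'M[R]_n) : continuous (mulmx h : 'M[R]_n -> 'M[R]_n).
Proof.
move=> M A [P /= MP sPA].
have : \forall N \near M, forall i j, P i j ((h *m N) i j).
  apply: (@filter_forall _ _ (fun i N => forall j, P i j ((h *m N) i j)) _ (nbhs_filter M)) => i.
  apply: (@filter_forall _ _ (fun j N => P i j ((h *m N) i j)) _ (nbhs_filter M)) => j.
  exact: (@entry_mulmx_continuous h i j M _ (MP i j)).
by apply: (@filterS _ _ (nbhs_filter M)) => N ?; exact: sPA.
Qed.

Lemma measurable_mulmx (h : 'M[R]_n) : measurable_fun [set: T] (mulmx h : T -> T).
Proof.
apply: (@measurability _ _ T T setT (mulmx h) (@open 'M[R]_n)) => //.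
move=> _ [A oA <-]; rewrite setTI; apply: open_measurable_mx.
by move/continuousP : (@mulmx_continuous h); apply.
Qed.

Lemma measurable_orthogonal : measurable O.
Proof.
rewrite (_ : O = \bigcap_(i in [set: 'I_n]) \bigcap_(j in [set: 'I_n])
  ([set: T] `&` (fun g : T => \sum_k (g : 'M[R]_n) k i * (g : 'M[R]_n) k j)
    @^-1` [set (i == j)%:R])).
  apply: fin_bigcap_measurable => // i _; apply: fin_bigcap_measurable => // j _.
  have : measurable_fun [set: T]
      (fun g : T => \sum_k (g : 'M[R]_n) k i * (g : 'M[R]_n) k j).
    apply: measurable_sum => k; apply: measurable_funM; exact: measurable_entry.
  by apply => //; exact: measurable_set1.
apply/seteqP; split=> g.
  move=> og i _ j _; split=> //=.
  move/matrixP : og => /(_ i j); rewrite !mxE => <-.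
  by apply: eq_bigr => k _; rewrite mxE.
move=> H; apply/matrixP => i j; have [_ /= e] := H i I j I.
by rewrite [RHS]mxE -e mxE; apply: eq_bigr => k _; rewrite mxE.
Qed.

End BorelMatrices.

(** * Fourth moments of the entries of a Haar orthogonal matrix *)

Section Rintegral_sum.
Context d (T : measurableType d) (R : realType) (mu : {measure set T -> \bar R}).

Lemma Rintegral_sum (I : finType) (P : pred I) (D : set T) (f : I -> T -> R) :
  measurable D -> (forall i, mu.-integrable D (EFin \o f i)) ->
  \int[mu]_(x in D) (\sum_(i | P i) f i x) = \sum_(i | P i) \int[mu]_(x in D) f i x.
Proof.
move=> mD intf; rewrite /Rintegral.
under eq_integral do rewrite -sumEFin.
rewrite integral_sum //.
by rewrite -sum_fine // => i _; exact: integrable_fin_num (intf i).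
Qed.

End Rintegral_sum.

Section HaarMoments.
Variables (R : realType) (n : nat).
Local Notation T := (borel_mx R n).
Local Notation O := (@orthogonal_mx R n : set T).
Variables (mu : probability T R) (haar : is_haar_On mu).

Lemma orthogonal_col (g : 'M[R]_n) a : orthogonal_mx g -> \sum_i g i a ^+ 2 = 1.
Proof.
move=> /matrixP/(_ a a); rewrite !mxE eqxx mulr1n => <-.
by apply: eq_bigr => i _; rewrite mxE.
Qed.

Lemma orthogonal_entry_le1 (g : 'M[R]_n) i a : orthogonal_mx g -> g i a ^+ 2 <= 1.
Proof.
move=> /(orthogonal_col a) <-; rewrite (bigD1 i) //= lerDl sumr_ge0 // => k _.
exact: sqr_ge0.
Qed.

Lemma integrable_bounded_orthogonal (f : T -> R) (C : R) :
  measurable_fun [set: T] f -> (forall g, O g -> `|f g| <= C) ->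
  mu.-integrable O (EFin \o f).
Proof.
move=> mf fC; apply: measurable_bounded_integrable.
- exact: measurable_orthogonal.
- by rewrite (le_lt_trans (probability_le1 mu (@measurable_orthogonal R n))) // ltry.
- exact: measurable_funTS.
by exists C; split; [exact: num_real|move=> M CM g /fC /le_trans; apply; exact: ltW].
Qed.

Lemma haar_invariance (h : 'M[R]_n) (f : T -> R) : orthogonal_mx h ->
  measurable_fun [set: T] f -> (forall g, 0 <= f g) ->
  \int[mu]_(g in O) f (h *m g) = \int[mu]_(g in O) f g.
Proof.
move=> oh mf f0; congr fine.
have preO : mulmx h @^-1` O = O.
  by apply/seteqP; split=> g; rewrite /preimage /= /orthogonal_mx /= trmx_mul
    mulmxA -(mulmxA _ h^T) oh mulmx1.
transitivity (\int[mu]_(g in mulmx h @^-1` O) (EFin \o f) (mulmx h g))%E.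
  by rewrite preO.
rewrite -(@ge0_integral_pushforward _ _ T T R _ (measurable_mulmx h) mu O (EFin \o f)).
- apply: eq_measure_integral => [|? A mA _]; first exact: measurable_mulmx.
  exact: (haar.2 h A oh mA).
- exact: measurable_orthogonal.
- by apply/measurable_EFinP; exact: measurable_funTS.
by move=> g _; rewrite lee_fin.
Qed.

(** For [i != j] this is the 2 x 2 Hadamard matrix, normalised to be orthogonal,
    in the coordinates [i] and [j]. It is given by its rows, so that its action
    on the rows of a matrix is immediate. *)
Definition hadamard_mx (i j : 'I_n) : 'M[R]_n :=
  \matrix_p (if p == i then (Num.sqrt 2)^-1 *: (delta_mx 0 i + delta_mx 0 j)
             else if p == j then (Num.sqrt 2)^-1 *: (delta_mx 0 i - delta_mx 0 j)
             else delta_mx 0 p).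

Lemma hadamard_mxE (i j : 'I_n) (g : 'M[R]_n) p q :
  (hadamard_mx i j *m g) p q =
    if p == i then (Num.sqrt 2)^-1 * (g i q + g j q)
    else if p == j then (Num.sqrt 2)^-1 * (g i q - g j q)
    else g p q.
Proof.
transitivity (row p (hadamard_mx i j *m g) 0 q); first by rewrite [RHS]mxE.
rewrite row_mul rowK; case: ifP => _; last case: ifP => _.
- by rewrite -scalemxAl mulmxDl -!rowE !mxE.
- by rewrite -scalemxAl mulmxBl -!rowE !mxE.
by rewrite -rowE mxE.
Qed.

Lemma sqrt2V : (Num.sqrt 2)^-1 ^+ 2 = 2^-1 :> R.
Proof. by rewrite exprVn sqr_sqrtr. Qed.

Lemma hadamard_mx_orthogonal (i j : 'I_n) : i != j -> orthogonal_mx (hadamard_mx i j).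
Proof.
move=> ij; have ji : j == i = false by rewrite eq_sym (negPf ij).
have entry p q : hadamard_mx i j p q =
    if p == i then (Num.sqrt 2)^-1 * ((i == q)%:R + (j == q)%:R)
    else if p == j then (Num.sqrt 2)^-1 * ((i == q)%:R - (j == q)%:R)
    else (p == q)%:R.
  by rewrite -[hadamard_mx i j]mulmx1 hadamard_mxE !mxE.
have -> : orthogonal_mx (hadamard_mx i j) = (hadamard_mx i j *m hadamard_mx i j = 1%:M).
  rewrite /orthogonal_mx /=; congr (_ *m _ = _); apply/matrixP => p q.
  rewrite mxE !entry.
  case: (eqVneq p i) => [->|pi]; [|case: (eqVneq p j) => [->|pj]];
    (case: (eqVneq q i) => [e|_]; [rewrite ?e|case: (eqVneq q j) => [e|_]; [rewrite ?e|]]);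
    rewrite ?eqxx ?ji ?(negPf ij) /= ?addr0 ?add0r ?subr0 ?oppr0 ?mulr0 // ?(eq_sym q p) //.
    by rewrite (negPf pi).
  by rewrite (negPf pj).
apply/matrixP => p q; rewrite hadamard_mxE !entry ji !eqxx !mxE.
have := sqrt2V; set c := (Num.sqrt 2)^-1 => c2.
case: (eqVneq p i) => [->|pi].
  transitivity (c ^+ 2 * 2 * (i == q)%:R); first by ring.
  by rewrite c2 mulVf ?pnatr_eq0 // mul1r.
case: (eqVneq p j) => [->|pj] //.
transitivity (c ^+ 2 * 2 * (j == q)%:R); first by ring.
by rewrite c2 mulVf ?pnatr_eq0 // mul1r.
Qed.

Variable a : 'I_n.
Local Notation q i := (\int[mu]_(g in O) ((g : 'M[R]_n) i a ^+ 4)).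
Local Notation r i j :=
  (\int[mu]_(g in O) ((g : 'M[R]_n) i a ^+ 2 * (g : 'M[R]_n) j a ^+ 2)).

Lemma integrable_entry4 i : mu.-integrable O (EFin \o (fun g : T => (g : 'M[R]_n) i a ^+ 4)).
Proof.
apply: (@integrable_bounded_orthogonal _ 1).
  by apply: measurable_funX; exact: measurable_entry.
move=> g /(orthogonal_entry_le1 i a) g1.
by rewrite (exprM _ 2 2) ger0_norm ?sqr_ge0 //; apply: exprn_ile1 => //; exact: sqr_ge0.
Qed.

Lemma integrable_entry22 i j : mu.-integrable O
  (EFin \o (fun g : T => (g : 'M[R]_n) i a ^+ 2 * (g : 'M[R]_n) j a ^+ 2)).
Proof.
apply: (@integrable_bounded_orthogonal _ 1).
  by apply: measurable_funM; apply: measurable_funX; exact: measurable_entry.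
move=> g og; rewrite ger0_norm; last by apply: mulr_ge0; exact: sqr_ge0.
by apply: mulr_ile1; rewrite ?(orthogonal_entry_le1 _ _ og) ?sqr_ge0.
Qed.

(** For [i != j] this is an equality. With [u] and [v] two entries of a column,
    [((u + v) ^ 4 + (u - v) ^ 4) / 4 = (u ^ 4 + v ^ 4) / 2 + 3 u ^ 2 v ^ 2], and
    by invariance the left-hand side has the same mean as [u ^ 4 + v ^ 4]. The
    inequality for [i = j] lets one sum over all pairs. *)
Lemma entry_moment_hadamard i j : q i + q j <= 6 * r i j.
Proof.
have mO := @measurable_orthogonal R n.
have [<-|ij] := eqVneq i j.
  rewrite (_ : r i i = q i); last by apply: eq_Rintegral => g _; rewrite -exprD.
  have : 0 <= q i by apply: Rintegral_ge0 => g _; rewrite (exprM _ 2 2) sqr_ge0.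
  by lra.
have oh := hadamard_mx_orthogonal ij.
have ji : j == i = false by rewrite eq_sym (negPf ij).
have inv p : q p = \int[mu]_(g in O) ((hadamard_mx i j *m (g : 'M[R]_n)) p a ^+ 4).
  rewrite (@haar_invariance _ (fun g : T => (g : 'M[R]_n) p a ^+ 4)) //.
    by apply: measurable_funX; exact: measurable_entry.
  by move=> g; rewrite (exprM _ 2 2) sqr_ge0.
have int_inv p : mu.-integrable O
    (EFin \o (fun g : T => (hadamard_mx i j *m (g : 'M[R]_n)) p a ^+ 4)).
  apply: (@integrable_bounded_orthogonal _ 1).
    apply: measurable_funX.
    exact: (measurableT_comp (measurable_entry p a) (measurable_mulmx (hadamard_mx i j))).
  move=> g og; have /(orthogonal_entry_le1 p a) g1 : orthogonal_mx (hadamard_mx i j *m g).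
    by rewrite /orthogonal_mx /= trmx_mul mulmxA -(mulmxA _ _^T) oh mulmx1.
  by rewrite (exprM _ 2 2) ger0_norm ?sqr_ge0 //; apply: exprn_ile1 => //; exact: sqr_ge0.
have : q i + q j = 2^-1 * (q i + q j) + 3 * r i j; last by lra.
rewrite [in LHS](inv i) [in LHS](inv j) -RintegralD //.
have i4 := integrable_entry4; have i22 := integrable_entry22 i j.
have i4D := integrableD mO (i4 i) (i4 j).
have intZ c (f : T -> R) : mu.-integrable O (EFin \o f) ->
    mu.-integrable O (EFin \o (fun g => c * f g)).
  by move=> /(integrableZl mO c); apply: eq_integrable => // g _; rewrite /= EFinM.
rewrite -(RintegralD mO (i4 i) (i4 j)) -!RintegralZl // -RintegralD //.
- apply: eq_Rintegral => g _; rewrite !hadamard_mxE eqxx ji eqxx.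
  have := sqrt2V; set c := (Num.sqrt 2)^-1 => c2.
  rewrite !exprMn (exprM c 2 2) c2; by field.
- exact: intZ.
- exact: intZ.
Qed.

(** Sum [entry_moment_hadamard] over all pairs of rows: as columns are unit
    vectors, the mixed moments add up to [1]. *)
Lemma sum_entry_moment4 : n%:R * \sum_i q i <= 3.
Proof.
have mO := @measurable_orthogonal R n.
have sumr1 : \sum_i \sum_j r i j = 1.
  transitivity (\int[mu]_(g in O) (cst 1 g : R)).
    under eq_bigr => i _ do rewrite -(Rintegral_sum _ mO (integrable_entry22 i)).
    rewrite -(Rintegral_sum _ mO) => [|i]; last first.
      apply: (@integrable_bounded_orthogonal _ 1).
        by apply: measurable_sum => j; apply: measurable_funM;
          apply: measurable_funX; exact: measurable_entry.
      move=> g og; rewrite -mulr_sumr orthogonal_col // mulr1.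
      by rewrite ger0_norm ?sqr_ge0 // orthogonal_entry_le1.
    apply: eq_Rintegral => g; rewrite inE => og.
    under eq_bigr => i _ do rewrite -mulr_sumr orthogonal_col // mulr1.
    by rewrite orthogonal_col.
  rewrite Rintegral_cst // mul1r -[RHS]/(fine 1%E); congr fine; exact: haar.1.
have : \sum_i \sum_j (q i + q j) <= \sum_i \sum_j (6 * r i j).
  by apply: ler_sum => i _; apply: ler_sum => j _; exact: entry_moment_hadamard.
under [leRHS]eq_bigr => i _ do rewrite -mulr_sumr.
rewrite -mulr_sumr sumr1.
under eq_bigr => i _ do rewrite big_split /= sumr_const card_ord.
rewrite big_split /= sumr_const card_ord sumrMnl -!(mulr_natl (\sum_i _) n).
by lra.
Qed.

End HaarMoments.

(** * Integral bounds without measurability *)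

Section UnmeasuredBounds.
Local Open Scope ereal_scope.
Context d (T : measurableType d) (R : realType) (mu : probability T R).
Variables (f : T -> \bar R) (A : set T) (c : R).
Hypotheses (mA : measurable A) (f0 : forall x, 0 <= f x) (c0 : (0 <= c)%R).

Import HBNNSimple.

(** The integral of a nonnegative function is the supremum of the integrals of
    the simple functions below it, whether or not the function is measurable.
    So this bound and the next one hold for the face-counting function without
    a proof that it is measurable. *)
Lemma integral_le_cst : mu A = 1 -> (forall x, A x -> f x <= c%:E) ->
  \int[mu]_x f x <= c%:E.
Proof.
move=> muA fc; rewrite ge0_integralTE //.
apply: ge_ereal_sup => _ [h hf <-]; rewrite -integralT_nnsfun.
rewrite (_ : c%:E = \int[mu]_x (cst c%:E x)); last first.
  rewrite integral_cst // -[LHS]mule1; congr (_ * _).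
  by apply/esym; exact: (probability_setT mu).
apply: ae_ge0_le_integral => //.
- by move=> x _; rewrite lee_fin.
- exact/measurable_EFinP.
exists (~` A); split; first exact: measurableC.
  apply: (etrans (probability_setC mu mA)).
  by rewrite -(subee (x := 1)) //; congr (1 - _).
by apply: subsetC => x Ax _; exact: le_trans (hf x) (fc x Ax).
Qed.

Lemma cst_le_integral : (forall x, A x -> c%:E <= f x) ->
  c%:E * mu A <= \int[mu]_x f x.
Proof.
move=> cf; rewrite ge0_integralTE // -(@sintegral_indic _ _ _ mu A).
rewrite -(sintegralrM mu c (indic_nnsfun R mA)).
apply: ereal_sup_ubound; exists (scale_nnsfun (indic_nnsfun R mA) c0) => // x.
rewrite /= mindicE; have [/set_mem /cf|_] := boolP (x \in A).
  by rewrite mulr1.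
by rewrite mulr0.
Qed.

End UnmeasuredBounds.

(** * The tail columns are flat with high probability *)

Section FlatEvent.
Variables (R : realType) (n : nat).
Local Notation T := (borel_mx R n).
Local Notation O := (@orthogonal_mx R n : set T).
Variables (mu : probability T R) (haar : is_haar_On mu).
Variable k : nat.

Definition tail_moment4 (g : T) : R :=
  \sum_(a < n | (k <= a)%N) \sum_i (g : 'M[R]_n) i a ^+ 4.

Definition flat_event (t : R) : set T := O `&` [set g | tail_moment4 g < t].

Lemma flat_entry eps g i (a : 'I_n) : 0 <= eps -> flat_event (eps ^+ 2) g ->
  (k <= a)%N -> (g : 'M[R]_n) i a ^+ 2 <= eps.
Proof.
move=> eps0 [_ /= flat] ka.
rewrite -(@ler_pXn2r _ 2) ?nnegrE ?sqr_ge0 // -exprM.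
apply: le_trans (ltW flat).
have ge0 j b : 0 <= (g : 'M[R]_n) j b ^+ 4 by rewrite (exprM _ 2 2) sqr_ge0.
rewrite /tail_moment4 (bigD1 a) //= (bigD1 i) //= -addrA lerDl addr_ge0 //.
  by apply: sumr_ge0.
by apply: sumr_ge0 => b _; apply: sumr_ge0.
Qed.

Lemma measurable_tail_moment4 : measurable_fun [set: T] tail_moment4.
Proof.
rewrite (_ : tail_moment4 = fun g : T => \sum_(a < n)
    (if (k <= a)%N then \sum_i (g : 'M[R]_n) i a ^+ 4 else 0)); last first.
  by apply/funext => g; rewrite /tail_moment4 big_mkcond.
apply: measurable_sum => a; case: (k <= a)%N; last exact: measurable_cst.
by apply: measurable_sum => i; apply: measurable_funX; exact: measurable_entry.
Qed.

Lemma tail_moment4_ge0 g : 0 <= tail_moment4 g.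
Proof.
by apply: sumr_ge0 => a _; apply: sumr_ge0 => i _; rewrite (exprM _ 2 2) sqr_ge0.
Qed.

Lemma tail_moment4_mean :
  n%:R * \int[mu]_(g in O) tail_moment4 g <= 3 * (n - k)%:R.
Proof.
have mO := @measurable_orthogonal R n.
rewrite /tail_moment4 Rintegral_sum // => [|a]; last first.
  apply: (@integrable_bounded_orthogonal _ _ mu _ n%:R).
    by apply: measurable_sum => i; apply: measurable_funX; exact: measurable_entry.
  move=> g og; rewrite ger0_norm; last first.
    by apply: sumr_ge0 => i _; rewrite (exprM _ 2 2) sqr_ge0.
  rewrite -[n in n%:R]card_ord -sum1_card natr_sum; apply: ler_sum => i _.
  rewrite (exprM _ 2 2); apply: exprn_ile1; first exact: sqr_ge0.
  exact: orthogonal_entry_le1.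
rewrite mulr_sumr.
apply: (@le_trans _ _ (\sum_(a < n | (k <= a)%N) 3)).
  apply: ler_sum => a _; rewrite Rintegral_sum // => [|i].
    exact: sum_entry_moment4.
  exact: integrable_entry4.
by rewrite sumr_const mulr_natr -card_ord_geq cardsE.
Qed.


Lemma measurable_flat_event t : measurable (flat_event t).
Proof.
apply: measurableI; first exact: measurable_orthogonal.
rewrite (_ : [set g | _] = [set: T] `&` tail_moment4 @^-1` `]-oo, t[%classic).
  by apply: measurable_tail_moment4 => //; exact: measurable_itv.
by rewrite setTI; apply/seteqP; split=> g; rewrite /= in_itv.
Qed.

Lemma integrable_tail_moment4 : mu.-integrable O (EFin \o tail_moment4).
Proof.
apply: (@integrable_bounded_orthogonal _ _ mu _ (\sum_(a < n | (k <= a)%N) \sum_(i < n) 1)).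
  exact: measurable_tail_moment4.
move=> g og; rewrite ger0_norm ?tail_moment4_ge0 //.
apply: ler_sum => a _; apply: ler_sum => i _.
rewrite (exprM _ 2 2); apply: exprn_ile1; first exact: sqr_ge0.
exact: orthogonal_entry_le1.
Qed.

(** Markov's inequality for [tail_moment4]. *)
Lemma flat_event_likely t : (0 < n)%N -> 0 < t ->
  ((1 - 3 * (n - k)%:R / t / n%:R)%:E <= mu (flat_event t))%E.
Proof.
move=> n0 t0; have mO := @measurable_orthogonal R n.
have n0R : 0 < n%:R :> R by rewrite ltr0n.
pose B : set T := [set g | (t%:E <= `|(tail_moment4 g)%:E|)%E].
have flatE : flat_event t = O `\` (O `&` B).
  apply/seteqP; split=> g [og /=]; rewrite /B /= lee_fin ger0_norm ?tail_moment4_ge0 //.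
    by move=> gt; split=> // -[_]; rewrite leNgt gt.
  by move=> ngt; split=> //=; rewrite ltNge; apply/negP => gt; apply: ngt.
have mOB : measurable (O `&` B).
  rewrite (_ : O `&` B = O `\` flat_event t); last first.
    by rewrite flatE setDD setIA setIid.
  by apply: measurableD => //; exact: measurable_flat_event.
have muO : mu O = 1%E := haar.1.
have finOB : mu (O `&` B) \is a fin_num by exact: fin_num_measure.
have muE : mu (flat_event t) = (1 - mu (O `&` B))%E.
  have muOy : (mu O < +oo)%E by rewrite muO ltry.
  have := measureD mO mOB muOy; rewrite setIA setIid flatE => muD.
  by apply: (etrans muD); congr (_ + _)%E.
have Emean := tail_moment4_mean.
have := le_integral_abse mu mO (measurable_funTS
  ((measurable_EFinP _ _).2 measurable_tail_moment4)) t0.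
rewrite muE -(fineK finOB) -EFinB lee_fin -/B.
set b := fine _.
rewrite (_ : (\int[mu]_(x in O) `|(EFin \o tail_moment4) x|)%E =
  (\int[mu]_(g in O) tail_moment4 g)%:E); last first.
  rewrite /Rintegral fineK; last exact: integrable_fin_num integrable_tail_moment4.
  by apply: eq_integral => g _; rewrite /= ger0_norm // tail_moment4_ge0.
move=> /(le_trans _) markov; have : (t%:E * b%:E <=
    (\int[mu]_(g in O) tail_moment4 g)%:E)%E.
  by apply: markov; rewrite /b fineK.
rewrite -EFinM lee_fin => tb; rewrite lerD2l lerN2 !ler_pdivlMr //.
by apply: le_trans Emean; rewrite -mulrA mulrC -mulrA ler_pM2l // mulrC.
Qed.

End FlatEvent.

(** * Bounds on the expected number of faces *)

Section ExpectedFaces.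
Variables (R : realType) (n d j k : nat).
Variables (mu : probability (borel_mx R n) R) (haar : is_haar_On mu).
Hypotheses (kE : k = (d + j)%N) (kn : (k <= n)%N).

Local Open Scope ereal_scope.

Let muO : mu (@orthogonal_mx R n) = 1 := haar.1.

Lemma counting_ge0 (T : choiceType) (A : set T) : 0 <= counting A :> \bar R.
Proof. by rewrite /counting; case: ifP => _; rewrite ?lee_fin ?leey. Qed.

Lemma expected_faces_le : expected_faces j k mu <= (2 ^ d * 'C(n, d))%:R%:E.
Proof.
apply: (integral_le_cst (@measurable_orthogonal R n)) => //.
  by move=> g; exact: counting_ge0.
by move=> g og; apply: counting_faces_le; rewrite dim_rand_subspace.
Qed.

Lemma expected_faces_ge (eps : R) : (0 < n)%N -> (0 < eps)%R ->
  (d%:R * ((n - k)%:R * eps) <= 4^-1)%R ->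
  ((2 ^ d * 'C(n, d))%:R * (1 - 3 * (n - k)%:R / eps ^+ 2 / n%:R))%R%:E
    <= expected_faces j k mu.
Proof.
move=> n0 eps0 small.
apply: (@le_trans _ _ ((2 ^ d * 'C(n, d))%:R%:E * mu (flat_event k (eps ^+ 2)))).
  rewrite EFinM lee_wpmul2l ?lee_fin ?ler0n //.
  by apply: flat_event_likely => //; exact: exprn_gt0.
apply: cst_le_integral => //.
- exact: measurable_flat_event.
- by move=> g; exact: counting_ge0.
move=> g flat; have og : orthogonal_mx (g : 'M[R]_n) := flat.1.
rewrite (@counting_faces_eq _ _ _ d) // ?dim_rand_subspace //.
apply: meets_all_faces_flat og _ small => i a ka.
exact: flat_entry (ltW eps0) flat ka.
Qed.

End ExpectedFaces.

(** * Asymptotics *)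

Section Asymptotics.
Variable R : realType.

(** By induction on [d]: each new factor is [(n - d) / n], which tends to [1]. *)
Lemma ffact_asymp d : ((n ^_ d)%:R / n%:R ^+ d : R) @[n --> \oo] --> (1 : R).
Proof.
have ratio (i : nat) : ((n - i)%N%:R / n%:R : R) @[n --> \oo] --> (1 : R).
  have lim : (1 - i%:R * harmonic n : R) @[n --> \oo] --> (1 - i%:R * 0 : R).
    by apply: cvgB; [exact: cvg_cst|apply: cvgMr; exact: cvg_harmonic].
  rewrite mulr0 subr0 in lim.
  rewrite -(cvg_shiftS (fun n : nat => (n - i)%N%:R / n%:R : R)).
  apply: cvg_trans lim; apply: near_eq_cvg; near=> n.
  have ni : (i <= n.+1)%N by near: n; exists i => // n /= /leqW.
  by rewrite /= natrB // mulrBl divff ?pnatr_eq0.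
elim: d => [|d IHd].
  by under eq_fun do rewrite ffactn0 expr0 divr1; exact: cvg_cst.
under eq_fun do rewrite ffactnSr natrM exprSr invfM mulrACA.
by have := cvgM IHd (ratio d); rewrite mulr1; apply.
Unshelve. all: by end_near. Qed.

End Asymptotics.

Theorem corollary3p4 (R : realType)
    (mu : forall n : nat, probability (borel_mx R n) R)
    (hmu : forall n : nat, is_haar_On (mu n))
    (l m : nat) (hl : (1 <= l)%N) (hlm : (l < m)%N) :
  asymp_equiv
    (fun n : nat => expected_faces (n - m) (n - l) (mu n))
    (fun n : nat => (2 * n%:R) ^+ (m - l) / ((m - l)`!)%:R).
Proof.
set d := (m - l)%N; have d0 : (0 < d)%N by rewrite subn_gt0.
(* The largest [eps] that [meets_all_faces_flat] accepts: there [n - k = l]. *)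
pose eps : R := (4 * (d * l)%:R)^-1.
have dl0 : 0 < (d * l)%:R :> R by rewrite ltr0n muln_gt0 d0.
have eps0 : 0 < eps by rewrite invr_gt0 mulr_gt0.
pose C : R := 3 * l%:R / eps ^+ 2.
pose b n : R := (n ^_ d)%:R / n%:R ^+ d.
have lower_lim : (b n * (1 - C / n%:R)) @[n --> \oo] --> (1 : R).
  have : (1 - C * n%:R^-1 : R) @[n --> \oo] --> (1 - C * 0 : R).
    apply: cvgB; first exact: cvg_cst.
    apply: cvgMr; rewrite -(cvg_shiftS (fun n : nat => n%:R^-1 : R)).
    exact: cvg_harmonic.
  rewrite mulr0 subr0 => lim; have := cvgM (@ffact_asymp R d) lim.
  by rewrite mulr1; apply.
rewrite /asymp_equiv; apply: (squeeze_cvge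
  (f := fun n => (b n * (1 - C / n%:R))%:E) (h := fun n => (b n)%:E)); first last.
- by apply: cvg_EFin; [exact: nearW|exact: ffact_asymp].
- by apply: cvg_EFin; [exact: nearW|exact: lower_lim].
near=> n.
have mn : (m <= n)%N by near: n; exact: nbhs_infty_ge.
have ln : (l <= n)%N := leq_trans (ltnW hlm) mn.
have n0 : (0 < n)%N := leq_trans hl ln.
have n0R : 0 < n%:R :> R by rewrite ltr0n.
pose B : R := (2 * n%:R) ^+ d / (d`!)%:R.
have B0 : 0 < B by rewrite divr_gt0 ?exprn_gt0 ?mulr_gt0 // ltr0n fact_gt0.
have bE : b n = (2 ^ d * 'C(n, d))%:R / B.
  rewrite /b /B -bin_ffact !natrM natrX exprMn invfM invrK; field.
  by rewrite !expf_neq0 ?gt_eqF.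
have kE : (n - l = d + (n - m))%N by rewrite /d; lia.
have small : d%:R * ((n - (n - l))%:R * eps) <= 4^-1.
  by rewrite subKn // mulrA -natrM /eps invfM mulrCA divff ?mulr1 ?gt_eqF.
have upper := expected_faces_le (hmu n) kE (leq_subr _ _).
have lower := expected_faces_ge (hmu n) kE (leq_subr _ _) n0 eps0 small.
rewrite subKn // -/C in lower.
have Bv : (0 <= B^-1%:E)%E by rewrite lee_fin invr_ge0 ltW.
rewrite bE -/B; apply/andP; split.
  by rewrite mulrAC EFinM lee_wpmul2r.
by rewrite EFinM lee_wpmul2r.
Unshelve. all: by end_near. Qed.
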